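(* Let $P \in \mathcal{P}_\lambda(\mathcal{X})$ be a non-trivial target probability distribution and let $f$ be a function such that $\mathcal{D}_f$ defines an $f$-divergence. Let $\mathcal{Q} \subseteq \mathcal{P}_\lambda(\mathcal{X})$ be a set of candidate probability distributions, each satisfying matching generative odds with $P$, and such that there exists $Q^\star \in \arg\min_{Q \in \overline{\mathcal{Q}}_{\mathcal{A}}} \mathcal{D}_f(P\|Q)$, where $\overline{\mathcal{Q}}_{\mathcal{A}}$ is the conditional closure of $\mathcal{Q}$. Then for any $\delta>0$, if $Q\in\mathcal{Q}$ and $P$ satisfy $\delta$-equalized generative treatment with respect to $\mathcal{D}_f$, then $$\mathcal{D}_f(P\|Q) \;\geq\; \max_{a\in\mathcal{A}} \mathcal{D}_f(P_a\|Q_a^\star) - \delta.$$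
   Context: Setting: $\mathcal{X} \subset \mathbb{R}^d$, $\lambda$ is the Lebesgue measure, and $\mathcal{P}_\lambda(\mathcal{X})$ is the set of probability distributions on $\mathcal{X}$ that are absolutely continuous with respect to $\lambda$. For $P \in \mathcal{P}_\lambda(\mathcal{X})$, its density is $p = \frac{dP}{d\lambda}$, and $\mathrm{Supp}(P) = \{x \in \mathcal{X} \mid p(x) > 0\}$. $f$-divergence: let $f:(0,+\infty)\to(-\infty,+\infty]$ be convex and lower semi-continuous with $f(1)=0$; this is what is meant by ''$\mathcal{D}_f$ defines an $f$-divergence''. Set $f(0) = \lim_{t\to 0^+} f(t)$ and $\bar f(+\infty) = \lim_{t\to+\infty} f(t)/t$. For $P,Q \in \mathcal{P}_\lambda(\mathcal{X})$ with densities $p,q$, $$\mathcal{D}_f(P\|Q) = \int_{\mathrm{Supp}(Q)} f\!\left(\tfrac{p(x)}{q(x)}\right) q(x)\, d\lambda(x) + \bar f(+\infty)\, P(\mathcal{X}\setminus \mathrm{Supp}(Q)),$$ with the convention $0\times\infty = 0$. Sensitive attributes: $\mathcal{A}$ is a finite set and $\psi:\mathcal{X}\to\mathcal{A}$ is a (measurable) function defined on all of $\mathcal{X}$; it induces the partition of $\mathcal{X}$ into $\mathcal{X}_a = \{x\in\mathcal{X} \mid \psi(x)=a\}$, $a \in \mathcal{A}$. For a distribution $P\in\mathcal{P}_\lambda(\mathcal{X})$, $\pi_a^P = P(\mathcal{X}_a)$, and $P_a$ is the conditional distribution of $P$ on $\mathcal{X}_a$, with density $p_a(x) = \frac{p(x)}{\pi_a^P}\mathbf{1}_{\mathcal{X}_a}(x)$,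 so that $P=\sum_{a\in\mathcal{A}} \pi_a^P P_a$. $P$ is non-trivial if $\pi_a^P>0$ for all $a\in\mathcal{A}$. $\Delta(\mathcal{A})$ is the probability simplex over $\mathcal{A}$. Matching generative odds: $P$ and $Q$ satisfy matching generative odds if $\pi_a^Q = \pi_a^P$ for all $a\in\mathcal{A}$. Equalized generative treatment: for $\delta>0$, $Q$ and $P$ satisfy $\delta$-equalized generative treatment with respect to $\mathcal{D}_f$ if $\bigl|\mathcal{D}_f(P_a\|Q_a) - \mathcal{D}_f(P_{a'}\|Q_{a'})\bigr| \leq \delta$ for all $a,a'\in\mathcal{A}$. Conditional closure: for $\mathcal{Q}\subseteq\mathcal{P}_\lambda(\mathcal{X})$ and $a\in\mathcal{A}$, let $\mathcal{Q}_a = \{R \in \mathcal{P}_\lambda(\mathcal{X}_a) \mid \exists Q\in\mathcal{Q} \text{ with } Q_a = R\}$, and let $\Delta_{\mathcal{Q}} = \{(\pi_a)_{a\in\mathcal{A}}\in\Delta(\mathcal{A}) \mid \exists Q\in\mathcal{Q} \text{ with } (\pi_a^Q)_{a\in\mathcal{A}} = (\pi_a)_{a\in\mathcal{A}}\}$. The conditional closure of $\mathcal{Q}$ is $$\overline{\mathcal{Q}}_{\mathcal{A}} = \Bigl\{\sum_{a\in\mathcal{A}} \pi_a R_a \;\Big|\; (\pi_a)_{a\in\mathcal{A}}\in\Delta_{\mathcal{Q}} \text{ and } R_a\in\mathcal{Q}_a \text{ for all } a\in\mathcal{A}\Bigr\}.$$ *)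

(* Defs.v *)
From HB Require Import structures.
From mathcomp Require Import all_boot all_order all_algebra.
From mathcomp Require Import all_classical all_reals all_analysis.

Set Implicit Arguments.
Unset Strict Implicit.
Unset Printing Implicit Defensive.

Import Order.TTheory GRing.Theory Num.Theory.
Import numFieldNormedType.Exports.

Local Open Scope classical_set_scope.
Local Open Scope ring_scope.
Local Open Scope ereal_scope.

(** The library sigma-algebra on tuples is generated by the coordinate
projections, so on [n.-tuple (measurableTypeR R)] it is the Borel one. *)
Notation Rvec R n := (n.-tuple (measurableTypeR R)).

Section lebesgue_vec_step.
Context (R : realType) (n : nat).
Variable mu : {sigma_finite_measure set (Rvec R n) -> \bar R}.

Definition vcons (xv : measurableTypeR R * Rvec R n) : Rvec R n.+1 :=
  [the n.+1.-tuple (measurableTypeR R) of xv.1 :: xv.2].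

Lemma measurable_vcons : measurable_fun setT vcons.
Proof. exact: measurable_cons. Qed.

(** The product [lambda_1 \x mu], transported to [Rvec R n.+1]. *)
Definition lebesgue_vec_step : set (Rvec R n.+1) -> \bar R :=
  pushforward (@lebesgue_measure R \x mu) vcons.

Let mstep (A : set (Rvec R n.+1)) : measurable A -> measurable (vcons @^-1` A).
Proof.
by move=> mA; rewrite -[X in measurable X]setTI; exact: measurable_vcons.
Qed.

Let step0 : lebesgue_vec_step set0 = 0.
Proof. by rewrite /lebesgue_vec_step /pushforward preimage_set0 measure0. Qed.

Let step_ge0 A : 0 <= lebesgue_vec_step A.
Proof. by rewrite /lebesgue_vec_step /pushforward measure_ge0. Qed.

Let step_sigma_additive : semi_sigma_additive lebesgue_vec_step.
Proof.
move=> F mF tF mUF; rewrite /lebesgue_vec_step /pushforward preimage_bigcup.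
apply: measure_semi_sigma_additive.
- by move=> i; exact: mstep.
- apply/trivIsetP => /= i j _ _ ij; rewrite -preimage_setI.
  by move/trivIsetP : tF => /(_ _ _ _ _ ij) ->//; rewrite preimage_set0.
- by rewrite -preimage_bigcup; exact: mstep.
Qed.

HB.instance Definition _ := isMeasure.Build _ _ _ lebesgue_vec_step
  step0 step_ge0 step_sigma_additive.

Definition vuncons (v : Rvec R n.+1) : measurableTypeR R * Rvec R n :=
  (thead v, [tuple of behead v]).

Lemma vconsK : cancel vcons vuncons.
Proof.
move=> [x v]; rewrite /vuncons /vcons /=; congr (_, _).
exact/val_inj.
Qed.

Let step_sigma_finite : sigma_finite setT lebesgue_vec_step.
Proof.
have /sigma_finiteP[F [TF ndF Foo]] := sigma_finiteT (@lebesgue_measure R).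
have /sigma_finiteP[G [TG ndG Goo]] := sigma_finiteT mu.
exists (fun k => vuncons @^-1` (F k `*` G k)).
  rewrite -preimage_bigcup; apply/esym/seteqP; split => // v _.
  have [i _ Fi] : (\bigcup_i F i) (vuncons v).1 by rewrite -TF.
  have [j _ Gj] : (\bigcup_j G j) (vuncons v).2 by rewrite -TG.
  exists (maxn i j) => //; split.
  - by move: Fi; exact/subsetPset/ndF/leq_maxl.
  - by move: Gj; exact/subsetPset/ndG/leq_maxr.
move=> k; have [mF Fkoo] := Foo k; have [mG Gkoo] := Goo k; split.
  rewrite -[X in measurable X]setTI.
  apply: (@measurable_fun_pair _ _ _ _ _ _ (@thead n (measurableTypeR R))
    (fun v => [tuple of behead v])) => //.
  - exact: measurable_tnth.
  - exact: measurable_behead.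
  - exact: measurableX.
rewrite /lebesgue_vec_step /pushforward -comp_preimage.
rewrite (_ : vuncons \o vcons = id); last by apply/funext => xv; exact: vconsK.
by rewrite preimage_id product_measure1E// lte_mul_pinfty// ge0_fin_numE.
Qed.

HB.instance Definition _ := Measure_isSigmaFinite.Build _ _ _ lebesgue_vec_step
  step_sigma_finite.

End lebesgue_vec_step.

Fixpoint lebesgue_vec (R : realType) (n : nat) :
    {sigma_finite_measure set (Rvec R n) -> \bar R} :=
  match n with
  | 0%N => \d_([tuple] : Rvec R 0)
  | m.+1 => lebesgue_vec_step (lebesgue_vec R m)
  end.

(** Generator of an f-divergence: a convex, lower semi-continuous function
]0, +oo[ -> ]-oo, +oo] vanishing at 1.  [f] is a total function on [R] whose
values on ]-oo, 0] are irrelevant; since ]0, +oo[ is open, lower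
semi-continuity on it can be stated with the neighborhoods of [R]. *)
Record fdiv_generator (R : realType) (f : R -> \bar R) : Prop := {
  fdiv_gtNy : forall t, (0 < t)%R -> -oo < f t ;
  fdiv_convex : forall s t u, (0 < s)%R -> (0 < t)%R -> (0 <= u <= 1)%R ->
    f (u * s + (1 - u) * t)%R <= u%:E * f s + (1 - u)%:E * f t ;
  fdiv_lsc : forall t (c : R), (0 < t)%R -> c%:E < f t ->
    \forall s \near t, c%:E < f s ;
  fdiv_one : f 1%R = 0 }.

Definition fdiv_at0 (R : realType) (f : R -> \bar R) : \bar R :=
  lim (f t @[t --> (0 : R)^'+]).

Definition fdiv_at_infty (R : realType) (f : R -> \bar R) : \bar R :=
  lim (f t * (t^-1)%:E @[t --> +oo%R]).

Definition fdiv_ext (R : realType) (f : R -> \bar R) (t : R) : \bar R :=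
  if t == 0%R then fdiv_at0 f else f t.

Section divergence.
Context d (T : measurableType d) (R : realType).
Variable mu : {sigma_finite_measure set T -> \bar R}.
Implicit Types (X : set T) (P Q : probability T R).

(** Distributions on [X] are the probabilities on the ambient space that give
mass 1 to [X]. *)
Definition ac_distributions X : set (probability T R) :=
  [set P | P X = 1 /\ P `<< mu].

Definition density P (x : T) : R :=
  fine (Radon_Nikodym (charge_of_finite_measure P) mu x).

Definition Supp X P : set T := [set x | X x /\ (0 < density P x)%R].

(** The convention 0 * oo = 0 is that of the product on [\bar R]. *)
Definition fdiv X (f : R -> \bar R) P Q : \bar R :=
  \int[mu]_(x in Supp X Q)
     (fdiv_ext f (density P x / density Q x)%R * (density Q x)%:E)
  + fdiv_at_infty f * P (X `\` Supp X Q).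

End divergence.

Section fairness.
Context d (T : measurableType d) (R : realType).
Variable mu : {sigma_finite_measure set T -> \bar R}.
Variables (X : set T) (A : finType) (psi : T -> A).

Definition attr_cell (a : A) : set T := X `&` psi @^-1` [set a].

Hypothesis mcell : forall a, measurable (attr_cell a).
Implicit Types (P Q S : probability T R) (QQ : set (probability T R)).

(** [U |-> P (U `&` X_a) / P X_a]; if [P X_a = 0], where the conditional
distribution is undefined, [mnormalize] returns the dummy value [P]. *)
Definition cond_dist P (a : A) : probability T R :=
  mnormalize (mrestr P (mcell a)) P.

Definition non_trivial P : Prop := forall a, 0 < P (attr_cell a).

Definition matching_odds P Q : Prop :=
  forall a, Q (attr_cell a) = P (attr_cell a).

(** If both divergences are infinite, then [+oo - +oo = -oo] in [\bar R], so
the inequality fails. *)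
Definition equalized_treatment (f : R -> \bar R) (delta : R) P Q : Prop :=
  forall a a', `| fdiv mu X f (cond_dist P a) (cond_dist Q a)
                - fdiv mu X f (cond_dist P a') (cond_dist Q a') | <= delta%:E.

Definition simplex : set (A -> R) :=
  [set w | (forall a, 0 <= w a)%R /\ (\sum_(a : A) w a = 1)%R].

(** Two measures are the same when they agree on measurable sets; a
[probability] is a function on all sets, so this is weaker than [=]. *)
Definition same_dist P Q : Prop := forall U, measurable U -> P U = Q U.

(** Membership in [ac_distributions (attr_cell a)] excludes the dummy value
of [cond_dist]. *)
Definition cond_set QQ (a : A) : set (probability T R) :=
  [set S | ac_distributions mu (attr_cell a) S /\
           exists2 Q, QQ Q & same_dist (cond_dist Q a) S].

Definition odds_set QQ : set (A -> R) :=
  [set w | simplex w /\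
           exists2 Q, QQ Q & forall a, Q (attr_cell a) = (w a)%:E].

Definition cond_closure QQ : set (probability T R) :=
  [set S : probability T R | exists (w : A -> R) (r : A -> probability T R),
     [/\ odds_set QQ w,
         forall a, cond_set QQ a (r a) &
         forall U, measurable U -> S U = \sum_(a : A) (w a)%:E * r a U]].

Definition is_fdiv_argmin (f : R -> \bar R) P QQ Q : Prop :=
  QQ Q /\ forall Q', QQ Q' -> fdiv mu X f P Q <= fdiv mu X f P Q'.

End fairness.

(* Main.v *)
(** On distributions with the same odds as P, the divergence from P splits over
the cells X_a as the sum of pi_a D(P_a || Q_a).  The conditional closure lets
one replace a single conditional Q*_a by Q_a, so minimality of Q* forces
D(P_a || Q*_a) <= D(P_a || Q_a) for every a.  Finally D(P || Q), a mean of the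
D(P_b || Q_b), is at least any D(P_a || Q_a) up to delta. *)

Require Import Defs.
From HB Require Import structures.
From mathcomp Require Import all_boot all_order all_algebra.
From mathcomp Require Import all_classical all_reals all_analysis.
From mathcomp Require Import measurable_realfun.
From mathcomp Require Import ring lra.

Set Implicit Arguments.
Unset Strict Implicit.

Import Order.TTheory GRing.Theory Num.Theory.
Import numFieldNormedType.Exports.

Local Open Scope classical_set_scope.
Local Open Scope ring_scope.
Local Open Scope ereal_scope.

(** * Generators of f-divergences *)

Section generator.
Variables (R : realType) (f : R -> \bar R).
Hypothesis hf : fdiv_generator f.

(* Lower semi-continuity bounds [f] below near 1, and convexity along the
segment from 1 propagates the bound at linear rate; no subgradient of [f] at 1
is needed (none may exist). *)
Lemma fdiv_generator_ge : exists2 C : R, (0 <= C)%R &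
  forall t, (0 < t)%R -> (- C * (1 + t))%:E <= f t.
Proof.
have [e /= e0 fe] : \forall s \near (1 : R)%R, (-1)%:E < f s.
  by apply: (fdiv_lsc hf) => //; rewrite (fdiv_one hf) lte_fin; lra.
(* Taking [r < e] keeps points at distance [r] from 1 inside the ball where [f] exceeds -1. Taking
   [r < 1] makes the constant [r^-1] larger than 1, which settles every [t] closer to 1 than [r]. *)
pose r : R := (Num.min (e / 2) (1 / 2))%R.
have r0 : (0 < r)%R by rewrite lt_min; apply/andP; split; lra.
have re : (r < e)%R by rewrite gt_min; apply/orP; left; lra.
have r1 : (r < 1)%R by rewrite gt_min; apply/orP; right; lra.
have rV : (1 < r^-1)%R by rewrite -[ltLHS]invr1 ltf_pV2 ?posrE.
exists (r^-1)%R; first by rewrite invr_ge0 ltW.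
move=> t t0; have [tr|tr] := ltP `|1 - t|%R r.
  apply: (@le_trans _ _ (-1)%:E).
    rewrite lee_fin; have : (0 < r^-1 * t)%R by rewrite mulr_gt0// invr_gt0.
    by rewrite mulNr mulrDr mulr1; lra.
  by apply/ltW/fe; rewrite /= (lt_trans tr).
set m := `|1 - t|%R in tr.
have m0 : (0 < m)%R := lt_le_trans r0 tr.
(* The weight [r / m] on [t] puts the convex combination of [t] and 1 at distance exactly [r] from
   1. *)
have u01 : (0 <= r / m <= 1)%R.
  by rewrite divr_ge0 ?(ltW r0) ?(ltW m0)//= ler_pdivrMr// mul1r.
have m1 : (m <= 1 + t)%R by rewrite /m ler_norml; apply/andP; split; lra.
have := fdiv_convex hf t0 (ltr01 : (0 < 1 :> R)%R) u01.
rewrite (fdiv_one hf) mule0 adde0 => cvx.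
have : (-1)%:E < (r / m)%:E * f t.
  apply: lt_le_trans cvx; apply: fe => /=.
  have -> : (1 - (r / m * t + (1 - r / m) * 1) = r / m * (1 - t))%R.
    by ring.
  rewrite normrM -/m ger0_norm; last by case/andP: u01.
  by rewrite divfK// gt_eqF.
case: (f t) (fdiv_gtNy hf t0) => [y _|_ _|//]; last by rewrite leey.
rewrite -EFinM lte_fin lee_fin => yr.
rewrite -(@ler_pM2l _ r)// mulrA mulrN divff ?gt_eqF// mulN1r.
have : (- m <= r * y)%R.
  by rewrite -(@ler_pM2l _ (m^-1)%R) ?invr_gt0// mulrN mulVf ?gt_eqF// mulrA
    [(m^-1 * r)%R]mulrC ltW.
by move=> /(le_trans _); apply; rewrite lerN2.
Qed.

(* Whether the limits defining [fdiv_at0] and [fdiv_at_infty] exist is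
immaterial: [lim] of a divergent filter is [point = 0]. *)
Lemma fdiv_at0_gtNy : -oo < fdiv_at0 f.
Proof.
have [C C0 fC] := fdiv_generator_ge; rewrite /fdiv_at0.
have [cf|/dvgP ->] := pselect (cvg (f t @[t --> (0 : R)^'+])); last exact: ltNyr.
apply: (@lt_le_trans _ _ (- C * (1 + 1))%:E); first exact: ltNyr.
apply: lime_ge => //; near=> t.
have t0 : (0 < t)%R by near: t; exact: nbhs_right_gt.
have t1 : (t < 1)%R by near: t; exact: nbhs_right_lt.
apply: le_trans (fC _ t0); rewrite lee_fin ler_wnM2l// ?oppr_le0//; lra.
Unshelve. all: by end_near. Qed.

Lemma fdiv_at_infty_gtNy : -oo < fdiv_at_infty f.
Proof.
have [C C0 fC] := fdiv_generator_ge; rewrite /fdiv_at_infty.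
have [cf|/dvgP ->] := pselect (cvg (f t * (t^-1)%:E @[t --> +oo%R]));
  last exact: ltNyr.
apply: (@lt_le_trans _ _ (- C * (1 + 1))%:E); first exact: ltNyr.
apply: lime_ge => //; near=> t.
have t1 : (1 < t)%R by near: t; exact: nbhs_pinfty_gt.
have t0 : (0 < t)%R by lra.
apply: (@le_trans _ _ ((- C * (1 + t))%:E * (t^-1)%:E)).
  rewrite -EFinM lee_fin -mulrA ler_wnM2l// ?oppr_le0// mulrDl mul1r.
  by rewrite divff ?gt_eqF// lerD2r invf_le1// ltW.
by rewrite lee_pmul2r ?lte_fin ?invr_gt0//; exact: fC.
Unshelve. all: by end_near. Qed.

(** [fdiv_ext] reads [f] at negative reals too, where [f] is arbitrary; a constant value there gives
    a function measurable on the whole line. *)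
Definition fdiv_pos (t : R) : \bar R := if (0 < t)%R then f t else fdiv_at0 f.

Lemma fdiv_posE t : (0 <= t)%R -> fdiv_pos t = fdiv_ext f t.
Proof.
by rewrite /fdiv_pos /fdiv_ext le0r => /predU1P[->|t0]; rewrite ?eqxx ?ltxx// t0 gt_eqF.
Qed.

Lemma fdiv_pos_ge : exists2 C : R, (0 <= C)%R &
  forall t, (0 <= t)%R -> (- C * (1 + t))%:E <= fdiv_pos t.
Proof.
have [C C0 fC] := fdiv_generator_ge.
have [B B0 fB] : exists2 B : R, (0 <= B)%R & (- B)%:E <= fdiv_at0 f.
  case: (fdiv_at0 f) fdiv_at0_gtNy => [y _|_|//]; last by exists 0%R; rewrite ?leey.
  by exists `|y|%R => //; rewrite lee_fin lerNl -normrN ler_norm.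
exists (C + B)%R; first exact: addr_ge0.
move=> t t0; rewrite /fdiv_pos; case: ifPn => [{}t0|_].
  apply: le_trans (fC _ t0); rewrite lee_fin.
  have : (0 <= B * (1 + t))%R by rewrite mulr_ge0//; lra.
  lra.
apply: le_trans fB; rewrite lee_fin.
have : (0 <= B * t)%R by rewrite mulr_ge0.
have : (0 <= C * (1 + t))%R by rewrite mulr_ge0//; lra.
lra.
Qed.

(** By lower semi-continuity, the part of a superlevel set lying in ]0, +oo[ is open; what remains
    is a half-line or empty. *)
Lemma measurable_fdiv_pos : measurable_fun setT fdiv_pos.
Proof.
apply: (measurability _ (measurable_realfun.ErealGenOInfty.measurableE R)).
move=> /= _ [_ [a ->]] <-; rewrite setTI preimage_itvoy.
pose O := [set t : R | (0 < t)%R /\ a%:E < f t].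
have mO : measurable O.
  apply: open_measurable; rewrite openE => t [t0 ft].
  near=> s; split; near: s; first exact: lt_nbhsr.
  exact: (fdiv_lsc hf).
have -> : [set t | a%:E < fdiv_pos t] = O `|`
    (if a%:E < fdiv_at0 f then [set t : R | (t <= 0)%R] else set0).
  apply/seteqP; split => t /=; rewrite /fdiv_pos /O /=.
    case: ifPn => [t0 ft|]; first by left.
    by rewrite -leNgt => t0 ->; right.
  by case=> [[t0]|]; [rewrite t0|case: ifPn => //= ? t0; rewrite (le_gtF t0)].
apply: measurableU => //; case: ifPn => // _.
by rewrite -set_itvNyc; exact: measurable_itv.
Unshelve. all: by end_near. Qed.

End generator.

(** * Integrals *)

Section integral_complements.
Context d (T : measurableType d) (R : realType).
Variable mu : {measure set T -> \bar R}.
Implicit Types (D : set T) (g h : T -> \bar R).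

Import HBNNSimple.

(* A simple function below [h] stays below [g] once it is set to 0 on the null
set [N]: no measurability of [g] and [h] is needed. *)
Lemma ge0_le_integral_off_null N h g : measurable N -> mu N = 0 ->
  (forall x, 0 <= h x) -> (forall x, 0 <= g x) ->
  (forall x, ~ N x -> h x = g x) -> \int[mu]_x h x <= \int[mu]_x g x.
Proof.
move=> mN N0 h0 g0 hg; rewrite !ge0_integralTE//.
apply: ge_ereal_sup => _ [k /= kh <-].
have mCN := measurableC mN.
apply: (@le_trans _ _ (sintegral mu (proj_nnsfun k mCN))).
  rewrite -!integralT_nnsfun le_eqVlt; apply/orP; left; apply/eqP.
  apply: ge0_ae_eq_integral => //.
  - exact/measurable_EFinP.
  - exact/measurable_EFinP.
  - by move=> x _; rewrite lee_fin; exact: fun_ge0.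
  - by move=> x _; rewrite lee_fin; exact: fun_ge0.
  exists N; split => // x /=; apply: contra_notP => Nx _.
  by rewrite /= mindicE mem_set ?mulr1.
apply: ereal_sup_ubound; exists (proj_nnsfun k mCN) => //= x.
rewrite mindicE; have [Nx|Nx] := pselect (N x).
  by rewrite memNset ?mulr0//; exact: contrapT.
by rewrite mem_set// mulr1 -hg.
Qed.

(** The integrand of [fdiv] evaluates [f] at negative ratios wherever the chosen density of P is
    negative. This happens on a null set, but may spoil measurability. Positive and negative parts
    are compared in both directions off the null set. *)
Lemma ae_eq_integral_nonmeasurable D h g :
  ae_eq mu D h g -> \int[mu]_(x in D) h x = \int[mu]_(x in D) g x.
Proof.
move=> [N [mN N0 hgN]].
have hg x : ~ N x -> (h \_ D) x = (g \_ D) x.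
  move=> Nx; rewrite /patch; case: ifPn => // /set_mem Dx.
  by apply: contrapT => hgx; apply: Nx; apply: hgN => /(_ Dx).
rewrite integral_mkcond [RHS]integral_mkcond integralE [RHS]integralE.
congr (_ - _); apply/eqP; rewrite eq_le; apply/andP; split;
  apply: (ge0_le_integral_off_null mN N0) => x;
  rewrite ?funepos_ge0 ?funeneg_ge0// => /hg; by rewrite ?funeposE ?funenegE => ->.
Qed.

(** A divergence may be +oo, so integrability of [h] cannot be assumed; a finite negative part is
    enough to rule out oo - oo. *)
Lemma integralZl_neg_fin D h (c : R) : measurable D -> measurable_fun D h ->
  \int[mu]_(x in D) h^\- x < +oo -> (0 <= c)%R ->
  \int[mu]_(x in D) (c%:E * h x) = c%:E * \int[mu]_(x in D) h x.
Proof.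
move=> mD mh hoo c0; rewrite integralE [in RHS]integralE.
rewrite ge0_funeposM// ge0_funenegM//.
rewrite !ge0_integralZl_EFin//; last 2 first.
- exact: measurable_funeneg.
- exact: measurable_funepos.
have ? : \int[mu]_(x in D) h^\- x \is a fin_num by rewrite ge0_fin_numE// integral_ge0.
by rewrite [RHS]muleBr// fin_num_adde_defl// fin_numN.
Qed.

Lemma integral_gtNy_neg_fin D h : \int[mu]_(x in D) h^\- x < +oo ->
  -oo < \int[mu]_(x in D) h x.
Proof.
move=> hoo; rewrite integralE.
have : 0 <= \int[mu]_(x in D) h^\+ x by exact: integral_ge0.
have : \int[mu]_(x in D) h^\- x \is a fin_num by rewrite ge0_fin_numE// integral_ge0.
move: (integral _ _ _) (integral _ _ _) => [x| |] [y| |] //.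
by rewrite -EFinB ltNyr.
Qed.

(** Positive and negative parts are each additive over the pieces, and finiteness of the negative
    ones lets the differences be regrouped. *)
Lemma integral_fin_partition (A : finType) (F : A -> set T) D h :
  (forall a, measurable (F a)) -> trivIset setT F -> D = \bigcup_a F a ->
  measurable_fun D h -> \int[mu]_(x in D) h^\- x < +oo ->
  \int[mu]_(x in D) h x = \sum_(a : A) \int[mu]_(x in F a) h x.
Proof.
move=> mF tF DF; have FD a : F a `<=` D by rewrite DF; exact: bigcup_sup.
have {}DF : D = \big[setU/set0]_(a : A) F a.
  rewrite DF -bigcup_seq; apply: eq_bigcupl.
  by split => a //= _; exact: mem_index_enum.
have mD : measurable D by rewrite DF; exact: bigsetU_measurable.
have ge0E g : measurable_fun D g -> (forall x, 0 <= g x) ->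
    \int[mu]_(x in D) g x = \sum_(a : A) \int[mu]_(x in F a) g x.
  move=> mg g0; rewrite DF ge0_integral_bigsetU//.
  - exact: index_enum_uniq.
  - exact: sub_trivIset (@subsetT _ _) tF.
  - by rewrite -DF.
move=> mh hoo.
have mhn := measurable_funeneg mh; have mhp := measurable_funepos mh.
rewrite integralE !ge0E//; under [RHS]eq_bigr do rewrite integralE.
rewrite [RHS]big_split/= fin_num_sumeN// => a _.
rewrite ge0_fin_numE ?integral_ge0//; apply: le_lt_trans hoo.
exact: ge0_subset_integral.
Qed.

End integral_complements.

Lemma measure_fin_partition d (T : measurableType d) (R : realType)
    (mu : {measure set T -> \bar R}) (A : finType) (F : A -> set T) D :
  (forall a, measurable (F a)) -> trivIset setT F -> D = \bigcup_a F a ->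
  mu D = \sum_(a : A) mu (F a).
Proof.
move=> mF tF DF; have mD : measurable D.
  by rewrite DF; apply: fin_bigcup_measurable => // a _; exact: mF.
rewrite -[LHS]mul1e -integral_cst//.
rewrite (integral_fin_partition mF tF DF)//.
- by apply: eq_bigr => a _; rewrite integral_cst// mul1e.
- under eq_integral do rewrite funenegE/= max_r ?oppe_le0//.
  by rewrite integral0.
Qed.

(** * Densities and divergences on a subset *)

Section density.
Context d (T : measurableType d) (R : realType).
Variable mu : {sigma_finite_measure set T -> \bar R}.
Implicit Types (P Q : probability T R) (D : set T).

Local Notation RN P := (Radon_Nikodym (charge_of_finite_measure P) mu).

Lemma density_EFin P : P `<< mu -> EFin \o density mu P = RN P.
Proof.
by move=> Pmu; apply/funext => x; rewrite /density /= fineK// Radon_Nikodym_fin_num.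
Qed.

Lemma measurable_density P : P `<< mu -> measurable_fun setT (density mu P).
Proof.
by move=> Pmu; apply/measurable_EFinP; rewrite density_EFin.
Qed.

Lemma integrable_density P : P `<< mu ->
  mu.-integrable setT (EFin \o density mu P).
Proof. by move=> Pmu; rewrite density_EFin//; exact: Radon_Nikodym_integrable. Qed.

Lemma integral_density P D : P `<< mu -> measurable D ->
  P D = \int[mu]_(x in D) (density mu P x)%:E.
Proof.
move=> Pmu mD; rewrite -[RHS]/(\int[mu]_(x in D) (EFin \o density mu P) x).
by rewrite density_EFin// -Radon_Nikodym_integral.
Qed.

(** The derivative agrees almost everywhere with the one constructed for sigma-finite measures,
    which is nonnegative at every point. *)
Lemma density_ge0 P : P `<< mu -> \forall x \ae mu, (0 <= density mu P x)%R.
Proof.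
move=> Pmu.
have := @ae_eq_Radon_Nikodym_SigmaFinite _ _ _ P mu Pmu setT measurableT.
apply: filterS => x /(_ I) fE.
rewrite -lee_fin -[(density _ _ _)%:E]/((EFin \o density mu P) x) density_EFin//.
by rewrite -fE Radon_Nikodym_SigmaFinite.f_ge0.
Qed.

(** Both functions have the same integral over each measurable subset of [D]. *)
Lemma density_scale P1 P2 D (c : R) : P1 `<< mu -> P2 `<< mu -> measurable D ->
  (forall U, measurable U -> U `<=` D -> P1 U = c%:E * P2 U) ->
  \forall x \ae mu, D x -> density mu P1 x = (c * density mu P2 x)%R.
Proof.
move=> P1mu P2mu mD P12.
have iD P : P `<< mu -> mu.-integrable D (EFin \o density mu P).
  by move=> Pmu; apply: integrableS (integrable_density Pmu).
have : ae_eq mu D (EFin \o density mu P1) (fun x => c%:E * (density mu P2 x)%:E).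
  apply: integral_ae_eq => //; first exact: iD.
    by apply/measurable_funeM/measurable_int/iD.
  move=> E ED mE; rewrite integralZl//; last by apply: integrableS (iD _ P2mu).
  by rewrite -!integral_density// P12.
by apply: filterS => x + Dx => /(_ Dx) /= [].
Qed.

Lemma ac_measure_ae_eq P (U V : set T) : P `<< mu -> measurable U -> measurable V ->
  (\forall x \ae mu, U x <-> V x) -> P U = P V.
Proof.
move=> Pmu mU mV UV; rewrite !integral_density// integral_mkcond.
rewrite [RHS]integral_mkcond; apply: ae_eq_integral_nonmeasurable.
apply: filterS UV => x UVx _; rewrite /patch.
by have -> : (x \in U) = (x \in V) by apply/idP/idP; rewrite !inE => /UVx.
Qed.

(** A density is nonnegative only almost everywhere; truncation secures pointwise bounds at the cost
    of a null set. *)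
Definition pos_density P (x : T) : R := Num.max (density mu P x) 0%R.

Lemma pos_density_ge0 P x : (0 <= pos_density P x)%R.
Proof. by rewrite le_max lexx orbT. Qed.

Lemma measurable_pos_density P : P `<< mu -> measurable_fun setT (pos_density P).
Proof. by move=> Pmu; apply: measurable_maxr => //; exact: measurable_density. Qed.

Lemma integrable_pos_density P : P `<< mu ->
  mu.-integrable setT (EFin \o pos_density P).
Proof.
move=> Pmu; apply: le_integrable (integrable_density Pmu) => //.
  by apply/measurable_EFinP; exact: measurable_pos_density.
move=> x _ /=; rewrite lee_fin ger0_norm ?pos_density_ge0//.
by rewrite ge_max ler_norm normr_ge0.
Qed.

End density.

(** * Finiteness from below, homogeneity and additivity of the divergence *)

Section fdiv_theory.
Context d (T : measurableType d) (R : realType).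
Variable mu : {sigma_finite_measure set T -> \bar R}.
Variable f : R -> \bar R.
Hypothesis hf : fdiv_generator f.
Implicit Types (P Q : probability T R) (D : set T).

Local Notation pdens := (pos_density mu).

(** A measurable substitute for the integrand of [fdiv]. It vanishes where the density of Q is not
    positive, so it can be integrated over all of [D] instead of the support. *)
Definition fdiv_integrand P Q (x : T) : \bar R :=
  fdiv_pos f (pdens P x / pdens Q x)%R * (pdens Q x)%:E.

Lemma measurable_fdiv_integrand P Q D : P `<< mu -> Q `<< mu ->
  measurable_fun D (fdiv_integrand P Q).
Proof.
move=> Pmu Qmu; apply: measurable_funTS; apply: emeasurable_funM; last first.
  by apply/measurable_EFinP; exact: measurable_pos_density.
apply: (measurableT_comp (measurable_fdiv_pos hf)).
apply: measurable_funM; first exact: measurable_pos_density.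
(* On nonnegative reals the inverse is the power of exponent -1, and powers are measurable. *)
under eq_fun do rewrite -powR_inv1 ?pos_density_ge0//.
by apply: (measurableT_comp (measurable_powR _)); exact: measurable_pos_density.
Qed.

(** Multiplied by q, the linear lower bound [fdiv_pos_ge] at p/q becomes -C(q + p), which is
    integrable. *)
Lemma fdiv_integrand_neg_fin P Q D : P `<< mu -> Q `<< mu -> measurable D ->
  \int[mu]_(x in D) (fdiv_integrand P Q)^\- x < +oo.
Proof.
move=> Pmu Qmu mD; have [C C0 fC] := fdiv_pos_ge hf.
pose g x := C%:E * ((pdens Q x)%:E + (pdens P x)%:E).
have ig : mu.-integrable D g.
  apply: integrableZl => //; apply: integrableD => //.
  - by apply: integrableS (integrable_pos_density Qmu).
  - by apply: integrableS (integrable_pos_density Pmu).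
have g0 x : 0 <= g x.
  by apply: mule_ge0; rewrite ?adde_ge0 ?lee_fin ?pos_density_ge0.
have hg x : (fdiv_integrand P Q)^\- x <= g x.
  rewrite funenegE ge_max g0 andbT leeNl /fdiv_integrand.
  have p0 := pos_density_ge0 mu P x; have := pos_density_ge0 mu Q x.
  rewrite le0r => /predU1P[q0|q0].
    by rewrite q0 mule0 oppe_le0.
  have pq0 : (0 <= pdens P x / pdens Q x)%R by rewrite divr_ge0// ltW.
  have q0' : 0 <= (pdens Q x)%:E by rewrite lee_fin ltW.
  apply: le_trans (lee_wpmul2r q0' (fC _ pq0)).
  rewrite /g -EFinD -!EFinM -EFinN lee_fin mulNr mulNr lerN2 -mulrA.
  by rewrite mulrDl mul1r divfK ?gt_eqF.
apply: (@le_lt_trans _ _ (\int[mu]_(x in D) g x)).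
  apply: ge0_le_integral => //.
  - exact/measurable_funeneg/measurable_fdiv_integrand.
  - exact: measurable_int ig.
by have := integrable_fin_num mD ig; rewrite ge0_fin_numE// integral_ge0.
Qed.

Lemma fdivE P Q D : P `<< mu -> Q `<< mu ->
  fdiv mu D f P Q = \int[mu]_(x in D) fdiv_integrand P Q x
                    + fdiv_at_infty f * P (D `\` Supp mu D Q).
Proof.
move=> Pmu Qmu; rewrite /fdiv; congr (_ + _).
have -> : Supp mu D Q = D `&` [set x | (0 < density mu Q x)%R] by [].
rewrite integral_mkcondr; apply: ae_eq_integral_nonmeasurable.
apply: filterS (density_ge0 Pmu) => x p0 _.
rewrite /patch /fdiv_integrand /pos_density (max_l p0).
have [q0|q0] := ltP 0%R (density mu Q x).
  by rewrite mem_set// fdiv_posE// divr_ge0// ltW.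
by rewrite memNset /= ?mule0// (le_gtF q0).
Qed.

Lemma setD_Supp D Q : D `\` Supp mu D Q = D `&` [set x | (density mu Q x <= 0)%R].
Proof.
apply/seteqP; split => x [Dx].
  by move=> nS; split => //=; rewrite leNgt; apply/negP => q0; exact: nS.
by move=> /= q0; split => // -[_ /=]; rewrite ltNge q0.
Qed.

Lemma measurable_setD_Supp D Q : Q `<< mu -> measurable D ->
  measurable (D `\` Supp mu D Q).
Proof.
move=> Qmu mD; rewrite setD_Supp; apply: measurableI => //.
rewrite (_ : [set x | _] = [set: T] `&` density mu Q @^-1` [set r | (r <= 0)%R]).
  by apply: measurable_density => //; rewrite -set_itvNyc; exact: measurable_itv.
by rewrite setTI.
Qed.

Lemma fdiv_at_infty_mul_gtNy P D : measurable D -> -oo < fdiv_at_infty f * P D.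
Proof.
move=> mD; have := fdiv_at_infty_gtNy hf.
have PDf := fin_num_measure P D mD.
case: (fdiv_at_infty f) => [y _|_|]//.
  by rewrite -(fineK PDf) -EFinM ltNyr.
by rewrite (lt_le_trans (ltNyr 0%R))// mule_ge0.
Qed.

Lemma fdiv_gtNy P Q D : P `<< mu -> Q `<< mu -> measurable D ->
  -oo < fdiv mu D f P Q.
Proof.
move=> Pmu Qmu mD; rewrite fdivE//.
rewrite ltNye adde_eq_ninfty negb_or -!ltNye.
apply/andP; split; last exact/fdiv_at_infty_mul_gtNy/measurable_setD_Supp.
exact/integral_gtNy_neg_fin/fdiv_integrand_neg_fin.
Qed.

(** A common positive factor leaves p/q and the sign of q unchanged and multiplies both terms of the
    divergence by [c]. With [c = 1], the divergence on [D] depends only on the restrictions to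
    [D]. *)
Lemma fdiv_scale P1 Q1 P2 Q2 D (c : R) :
  P1 `<< mu -> Q1 `<< mu -> P2 `<< mu -> Q2 `<< mu -> measurable D -> (0 < c)%R ->
  (forall U, measurable U -> U `<=` D -> P1 U = c%:E * P2 U) ->
  (forall U, measurable U -> U `<=` D -> Q1 U = c%:E * Q2 U) ->
  fdiv mu D f P1 Q1 = c%:E * fdiv mu D f P2 Q2.
Proof.
move=> P1mu Q1mu P2mu Q2mu mD c0 P12 Q12.
have p12 := density_scale P1mu P2mu mD P12.
have q12 := density_scale Q1mu Q2mu mD Q12.
(* Neither term of the divergence is -oo, so [c] distributes over their sum. *)
rewrite !fdivE// muleDr//; last first.
  apply: ltninfty_adde_def; rewrite inE; last first.
    exact/fdiv_at_infty_mul_gtNy/measurable_setD_Supp.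
  exact/integral_gtNy_neg_fin/fdiv_integrand_neg_fin.
congr (_ + _).
  rewrite -integralZl_neg_fin ?ltW//; last 2 first.
  - exact: measurable_fdiv_integrand.
  - exact: fdiv_integrand_neg_fin.
  apply: ae_eq_integral_nonmeasurable.
  apply: filterS2 p12 q12 => x + + Dx => /(_ Dx) p12 /(_ Dx) q12.
  have maxM (y : R) : Num.max (c * y)%R 0%R = (c * Num.max y 0)%R.
    by rewrite maxr_pMr ?mulr0// ltW.
  rewrite /fdiv_integrand /pos_density p12 q12 !maxM EFinM muleCA.
  by rewrite -mulf_div divff ?gt_eqF// mul1r.
rewrite P12; [|exact: measurable_setD_Supp|exact: subDsetl].
rewrite muleCA; congr (_ * (_ * _)).
apply: (ac_measure_ae_eq P2mu); [exact: measurable_setD_Supp..|].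
apply: filterS q12 => x q12; rewrite !setD_Supp.
by split=> -[Dx /=]; rewrite q12// pmulr_rle0.
Qed.

Lemma fdiv_null P Q D : P `<< mu -> Q `<< mu -> measurable D ->
  P D = 0 -> Q D = 0 -> fdiv mu D f P Q = 0.
Proof.
move=> Pmu Qmu mD PD0 QD0; rewrite fdivE//.
have -> : P (D `\` Supp mu D Q) = 0.
  by apply: (subset_measure0 _ mD) => //; exact: measurable_setD_Supp.
rewrite mule0 adde0 -[RHS](@integral0 _ _ _ mu D).
apply: ae_eq_integral_nonmeasurable.
(* Q is 0 times itself on the subsets of [D], so [density_scale] with factor 0 makes its density
   vanish almost everywhere on [D]. *)
have : \forall x \ae mu, D x -> density mu Q x = (0 * density mu Q x)%R.
  apply: density_scale => // U mU UD; rewrite mul0e.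
  exact: (subset_measure0 mU mD).
apply: filterS => x + Dx => /(_ Dx); rewrite mul0r => q0.
by rewrite /fdiv_integrand /pos_density q0 maxxx mule0.
Qed.

Lemma fdiv_fin_partition (A : finType) (F : A -> set T) P Q D :
  P `<< mu -> Q `<< mu ->
  (forall a, measurable (F a)) -> trivIset setT F -> D = \bigcup_a F a ->
  fdiv mu D f P Q = \sum_(a : A) fdiv mu (F a) f P Q.
Proof.
move=> Pmu Qmu mF tF DF; have mD : measurable D.
  by rewrite DF; apply: fin_bigcup_measurable => // a _; exact: mF.
rewrite fdivE//; under [RHS]eq_bigr do rewrite fdivE//.
rewrite [RHS]big_split/=; congr (_ + _).
  apply: integral_fin_partition => //; first exact: measurable_fdiv_integrand.
  exact: fdiv_integrand_neg_fin.
rewrite -ge0_sume_distrr//; congr (_ * _).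
apply: measure_fin_partition.
- by move=> a; exact: measurable_setD_Supp.
- by under eq_fun do rewrite setD_Supp; exact: trivIset_setIr.
- rewrite setD_Supp DF setI_bigcupl; apply: eq_bigcupr => a _.
  by rewrite setD_Supp.
Qed.

End fdiv_theory.

(** * Conditional distributions and the conditional closure *)

Lemma mnormalize_mass1 d (T : measurableType d) (R : realType)
    (m : {measure set T -> \bar R}) (P : probability T R) U :
  m setT = 1 -> mnormalize m P U = m U.
Proof. by move=> m1; rewrite /mnormalize m1 onee_eq0/= invr1 mule1. Qed.

Section fairness_theory.
Context d (T : measurableType d) (R : realType).
Variable mu : {sigma_finite_measure set T -> \bar R}.
Variables (X : set T) (A : finType) (psi : T -> A).
Hypothesis mcell : forall a, measurable (attr_cell X psi a).
Implicit Types (P Q S : probability T R) (q : A -> probability T R) (U : set T).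

Local Notation cell := (attr_cell X psi).

Lemma bigcup_attr_cell : X = \bigcup_a cell a.
Proof. by apply/seteqP; split => [x Xx|x [a _ []]//]; exists (psi x). Qed.

Lemma trivIset_attr_cell : trivIset setT cell.
Proof. by apply: trivIset_setIl; exact: trivIset_preimage1. Qed.

Lemma measurable_bigcup_attr_cell : measurable X.
Proof.
by rewrite bigcup_attr_cell; apply: fin_bigcup_measurable => // a _; exact: mcell.
Qed.

Lemma attr_cellI (a b : A) : a != b -> cell a `&` cell b = set0.
Proof. by move=> ab; move/trivIsetP : trivIset_attr_cell; apply. Qed.

Lemma prob1_partition P U : P X = 1 -> measurable U ->
  P U = \sum_(b : A) P (U `&` cell b).
Proof.
move=> PX mU; have mX := measurable_bigcup_attr_cell.
have PXC : P (~` X) = 0 by rewrite probability_setC// PX subee.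
have -> : P U = P (U `&` X).
  rewrite (measureDI P mU mX) [X in X + _](_ : _ = 0) ?add0e//.
  by apply: subset_measure0 PXC; [exact: measurableD|exact: measurableC|move=> x []].
apply: measure_fin_partition => [a||].
- exact: measurableI.
- by apply: trivIset_setIl; exact: trivIset_attr_cell.
- by rewrite {1}bigcup_attr_cell setI_bigcupr.
Qed.

Lemma cond_distE P a U : 0 < P (cell a) ->
  cond_dist mcell P a U = ((fine (P (cell a)))^-1)%:E * P (U `&` cell a).
Proof.
move=> Pa; have Poo : P (cell a) < +oo by rewrite ltey_eq fin_num_measure.
rewrite /cond_dist /= /mnormalize.
case: ifPn => [/orP[]/eqP|_]; last first.
  by rewrite -[LHS]/(P (U `&` cell a) * _) muleC -[in RHS](setTI (cell a)) setIA setIT.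
all: rewrite -[X in X = _]/(P (setT `&` cell a)) setTI => Pe.
- by rewrite Pe in Poo.
- by rewrite Pe ltxx in Pa.
Qed.

Lemma cond_dist_ac P a : 0 < P (cell a) -> P `<< mu -> cond_dist mcell P a `<< mu.
Proof.
move=> Pa /null_content_dominatesP Pmu; apply/null_content_dominatesP => U mU U0.
rewrite cond_distE//; have -> : P (U `&` cell a) = 0; last by rewrite mule0.
by apply: (subset_measure0 _ mU) (Pmu _ mU U0); [exact: measurableI|exact: subIsetl].
Qed.

Lemma fine_cell_gt0 P a : 0 < P (cell a) -> (0 < fine (P (cell a)))%R.
Proof. by move=> Pa; rewrite fine_gt0// Pa ltey_eq fin_num_measure. Qed.

Lemma cond_dist_cellK P a U : 0 < P (cell a) -> U `<=` cell a ->
  P U = (fine (P (cell a)))%:E * cond_dist mcell P a U.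
Proof.
move=> Pa Ua; rewrite cond_distE// (setIidl Ua) muleA -EFinM divff ?mul1e//.
by rewrite gt_eqF// fine_cell_gt0.
Qed.

Lemma cond_dist_cell0 P (a b : A) : 0 < P (cell a) -> b != a ->
  cond_dist mcell P a (cell b) = 0.
Proof. by move=> Pa ba; rewrite cond_distE// attr_cellI// measure0 mule0. Qed.

Lemma cond_dist_cell1 P a : 0 < P (cell a) -> cond_dist mcell P a (cell a) = 1.
Proof.
move=> Pa; rewrite cond_distE// setIid -{2}(@fineK _ (P (cell a))) ?fin_num_measure//.
by rewrite -EFinM mulVf// gt_eqF// fine_cell_gt0.
Qed.

(** Both conditionals are null on the other cells, which contribute 0. On the cell of [a], matching
    odds make P and Q multiples of their conditionals by the same factor. *)
Lemma fdiv_cond_dist f P Q a : fdiv_generator f -> P `<< mu -> Q `<< mu ->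
  0 < P (cell a) -> Q (cell a) = P (cell a) ->
  (fine (P (cell a)))%:E *
    fdiv mu X f (cond_dist mcell P a) (cond_dist mcell Q a) =
  fdiv mu (cell a) f P Q.
Proof.
move=> hf Pmu Qmu Pa QPa; have Qa : 0 < Q (cell a) by rewrite QPa.
have cPmu := cond_dist_ac Pa Pmu; have cQmu := cond_dist_ac Qa Qmu.
rewrite (fdiv_fin_partition hf cPmu cQmu mcell trivIset_attr_cell bigcup_attr_cell).
rewrite (bigD1 a)//= big1 => [|b ba]; last first.
  by apply: fdiv_null => //; exact: cond_dist_cell0.
rewrite adde0; apply/esym/fdiv_scale => //; first exact: fine_cell_gt0.
- by move=> U _; exact: cond_dist_cellK.
- by move=> U _ Ua; rewrite -QPa; exact: cond_dist_cellK.
Qed.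

(** On each cell, S is the restriction of [q b]. This describes the conditional closure without
    normalizations: see [cond_closureP]. *)
Definition glued q S : Prop :=
  forall U, measurable U -> S U = \sum_(b : A) q b (U `&` cell b).

Lemma glued_sub_cell q S a U : glued q S -> measurable U -> U `<=` cell a ->
  S U = q a U.
Proof.
move=> gS mU Ua; rewrite gS// (bigD1 a)//= (setIidl Ua) big1 ?adde0// => b ba.
rewrite (_ : _ `&` _ = set0) ?measure0//; apply/seteqP; split => // x [/Ua xa xb].
by rewrite -(attr_cellI ba).
Qed.

Lemma glued_ac q S : glued q S -> (forall b, q b `<< mu) -> S `<< mu.
Proof.
move=> gS qmu; apply/null_content_dominatesP => U mU U0.
rewrite gS// big1// => b _; move/null_content_dominatesP : (qmu b); apply.
  exact: measurableI.
by apply: (subset_measure0 _ mU) => //; exact: measurableI.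
Qed.

Lemma fdiv_glued f q P S : fdiv_generator f -> P `<< mu ->
  (forall b, q b `<< mu) -> glued q S ->
  fdiv mu X f P S = \sum_(b : A) fdiv mu (cell b) f P (q b).
Proof.
move=> hf Pmu qmu gS; have Smu := glued_ac gS qmu.
rewrite (fdiv_fin_partition hf Pmu Smu mcell trivIset_attr_cell bigcup_attr_cell).
apply: eq_bigr => b _; rewrite -[RHS]mul1e.
apply: fdiv_scale => // U mU Ub; rewrite mul1e//.
exact: glued_sub_cell.
Qed.

(** S off the cell of [a] plus Q on it has mass 1, since Q and S give that cell the same mass. *)
Lemma glued_replace q P Q S a : glued q S -> Q (cell a) = S (cell a) ->
  exists S', glued (fun b => if b == a then Q else q b) S'.
Proof.
move=> gS QSa; have mCa := measurableC (mcell a).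
pose m := measure_add (mrestr S mCa) (mrestr Q (mcell a)).
have m1 : m setT = 1.
  rewrite /m measure_addE /= /mrestr !setTI QSa probability_setC//.
  by rewrite subeK// fin_num_measure.
(* As [m] already has mass 1, [mnormalize] only packs it as a probability; the default [P] is never
   reached. *)
exists (mnormalize m P) => U mU.
transitivity (m U); first exact: mnormalize_mass1.
rewrite /m measure_addE /= /mrestr gS; last exact: measurableI.
rewrite [RHS](bigD1 a)//= eqxx addeC; congr (_ + _).
rewrite (bigD1 a)//= -setIA setICl setI0 measure0 add0e.
apply: eq_bigr => b ba; rewrite (negbTE ba) -setIA; congr (q b (_ `&` _)).
apply/setIidr => x xb xa; suff : (cell b `&` cell a) x by rewrite attr_cellI.
by [].
Qed.

Section closure.
Variables (P : probability T R) (QQ : set (probability T R)).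
Hypothesis hPX : P X = 1.
Hypothesis hPnt : non_trivial X psi P.
Hypothesis hQQ : QQ `<=` ac_distributions mu X.
Hypothesis hodds : forall Q, QQ Q -> matching_odds X psi P Q.

Lemma attr_inhabited : exists a : A, True.
Proof.
apply: contrapT => nA; have := hPX.
rewrite (prob1_partition hPX measurable_bigcup_attr_cell) big1 => [/eqP|b _].
  by rewrite eq_sym onee_eq0.
by exfalso; apply: nA; exists b.
Qed.

Lemma sum_fine_odds : (\sum_(a : A) fine (P (cell a)) = 1)%R.
Proof.
apply: EFin_inj; rewrite -sumEFin -hPX.
rewrite (prob1_partition hPX measurable_bigcup_attr_cell).
by apply: eq_bigr => a _; rewrite setIA setIid fineK// fin_num_measure.
Qed.

(** All members of [QQ] have the odds of P, so the admissible weights are the cell masses of P, and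
    these cancel the normalization of each conditional. *)
Lemma cond_closureP S : cond_closure mu mcell QQ S <->
  exists2 q, forall b, QQ (q b) & glued q S.
Proof.
have odds0 Q a : QQ Q -> 0 < Q (cell a) by move=> /hodds ->; exact: hPnt.
split=> [[w [r [[_ [Q0 QQ0 wE]] rQ SE]]]|[q qQ gS]].
  have /choice[q qP] a : exists Q, QQ Q /\ same_dist (cond_dist mcell Q a) (r a).
    by have [_ [Q ? ?]] := rQ a; exists Q.
  exists q => [b|U mU]; first by have [] := qP b.
  rewrite SE//; apply: eq_bigr => b _; have [qb qr] := qP b.
  rewrite -wE -qr// cond_distE ?odds0// (hodds QQ0) (hodds qb) muleA.
  rewrite -{1}(@fineK _ (P (cell b))) ?fin_num_measure// -EFinM divff ?mul1e//.
  by rewrite gt_eqF// fine_cell_gt0//; exact: hPnt.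
(* [odds_set] requires a member of [QQ] realizing the weights; any [q a0] does, once some attribute
   value exists. *)
have [a0 _] := attr_inhabited.
exists (fun a => fine (P (cell a))), (fun a => cond_dist mcell (q a) a); split.
- split; first by split => [a|]; [rewrite fine_ge0|exact: sum_fine_odds].
  exists (q a0) => // a; rewrite (hodds (qQ a0)) fineK// fin_num_measure//.
- move=> a; split; last by exists (q a).
  split; first by rewrite /= cond_dist_cell1// odds0.
  by apply: cond_dist_ac; [exact: odds0|have [] := hQQ (qQ a)].
- move=> U mU; rewrite gS//; apply: eq_bigr => b _.
  rewrite -(hodds (qQ b)) (cond_dist_cellK (odds0 _ b (qQ b)) (@subIsetr _ U _)).
  by rewrite !cond_distE ?odds0// -setIA setIid.
Qed.

End closure.

End fairness_theory.

(** * Weighted sums of extended reals *)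

Section weighted_sums.
Variables (R : realType) (A : finType) (p : A -> R).
Hypothesis p0 : forall a, (0 < p a)%R.

(** A sum bounded by [z < +oo] with no term -oo has only finite terms, so the terms other than [a]
    cancel from both sides. *)
Lemma weighted_sum_term_le (e : A -> \bar R) (a : A) (y z : \bar R) :
  (forall b, -oo < e b) -> z < +oo ->
  \sum_(b : A) (p b)%:E * e b <= z ->
  \sum_(b : A) (p b)%:E * e b <=
    (p a)%:E * y + \sum_(b : A | b != a) (p b)%:E * e b ->
  e a <= y.
Proof.
move=> eNy zoo ez.
have pe_fin : \sum_(b : A) (p b)%:E * e b \is a fin_num.
  rewrite fin_numElt (le_lt_trans ez zoo) andbT ltNye esum_eqNy.
  apply/existsPn => b /=; rewrite -ltNye.
  case: (e b) (eNy b) => [x _|_|//]; first by rewrite -EFinM ltNyr.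
  by rewrite gt0_muley ?lte_fin.
have {}pe_fin b : (p b)%:E * e b \is a fin_num.
  by move/sum_fin_numP : pe_fin; apply => //; exact: mem_index_enum.
rewrite (bigD1 a)//= leeD2rE; last by apply/sum_fin_numP => b _ _.
by rewrite lee_pmul2l// lte_fin.
Qed.

(** Since the weights sum to 1, [x] and [c] are weighted means of themselves, and the comparison is
    made term by term. *)
Lemma le_weighted_mean (x : \bar R) (e : A -> \bar R) (c : R) :
  (\sum_(a : A) p a = 1)%R -> (forall a, e a \is a fin_num) ->
  (forall a, x <= e a + c%:E) ->
  x <= \sum_(a : A) (p a)%:E * e a + c%:E.
Proof.
move=> p1 efin xe.
have -> : x = \sum_(a : A) (p a)%:E * x.
  rewrite -ge0_sume_distrl => [|a _]; last by rewrite lee_fin ltW.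
  by rewrite sumEFin p1 mul1e.
have -> : c%:E = \sum_(a : A) (p a)%:E * c%:E.
  rewrite -ge0_sume_distrl => [|a _]; last by rewrite lee_fin ltW.
  by rewrite sumEFin p1 mul1e.
rewrite -big_split/=; apply: lee_sum => a _.
by rewrite -muleDr// ?fin_num_adde_defl// lee_pmul2l// lte_fin.
Qed.

End weighted_sums.

Unset Implicit Arguments.
Set Strict Implicit.

Theorem theorem4p3 (R : realType) (n : nat)
    (X : set (Rvec R n)) (mX : measurable X)
    (A : finType) (psi : Rvec R n -> A)
    (mcell : forall a, measurable (attr_cell X psi a))
    (P : probability (Rvec R n) R)
    (hP : ac_distributions (lebesgue_vec R n) X P)
    (hPnt : non_trivial X psi P)
    (f : R -> \bar R) (hf : fdiv_generator f)
    (QQ : set (probability (Rvec R n) R))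
    (hQQ : QQ `<=` ac_distributions (lebesgue_vec R n) X)
    (hodds : forall Q, QQ Q -> matching_odds X psi P Q)
    (Qstar : probability (Rvec R n) R)
    (hQstar : is_fdiv_argmin (lebesgue_vec R n) X f P
                (cond_closure (lebesgue_vec R n) mcell QQ) Qstar)
    (delta : R) (hdelta : (0 < delta)%R)
    (Q : probability (Rvec R n) R) (hQ : QQ Q)
    (hEGT : equalized_treatment (lebesgue_vec R n) mcell f delta P Q) :
  \big[maxe/-oo]_(a : A)
     fdiv (lebesgue_vec R n) X f (cond_dist mcell P a) (cond_dist mcell Qstar a)
  - delta%:E
  <= fdiv (lebesgue_vec R n) X f P Q.
Proof.
have [PX Pmu] := hP.
set mu := lebesgue_vec R n in hP hQQ hQstar hEGT Pmu *.
pose p a := fine (P (attr_cell X psi a)).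
have p0 a : (0 < p a)%R by exact/fine_cell_gt0/hPnt.
have closureP S := cond_closureP mcell PX hPnt hQQ hodds S.
have QQmu Q' : QQ Q' -> Q' `<< mu by move=> /hQQ[].
have cond_gt0 S a : S (attr_cell X psi a) = P (attr_cell X psi a) ->
  0 < S (attr_cell X psi a) by move=> ->; exact: hPnt.
pose dQ a := fdiv mu X f (cond_dist mcell P a) (cond_dist mcell Q a).
pose dS a := fdiv mu X f (cond_dist mcell P a) (cond_dist mcell Qstar a).
have [/closureP[q qQ gS] Smin] := hQstar.
have Smu : Qstar `<< mu by apply: (glued_ac mcell gS) => b; exact: QQmu.
have Sodds a : Qstar (attr_cell X psi a) = P (attr_cell X psi a).
  by rewrite (glued_sub_cell (a := a) gS)//; exact: hodds.
have Qodds a : Q (attr_cell X psi a) = P (attr_cell X psi a) by exact: hodds.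
have pdQ a : (p a)%:E * dQ a = fdiv mu (attr_cell X psi a) f P Q.
  by apply: fdiv_cond_dist => //; exact: QQmu.
have pdS a : (p a)%:E * dS a = fdiv mu (attr_cell X psi a) f P (q a).
  (* [Qstar] and [q a] agree inside the cell of [a], hence the factor 1. *)
  rewrite fdiv_cond_dist// -[RHS]mul1e; apply: fdiv_scale => //.
  - exact: QQmu.
  - by move=> U _ _; rewrite mul1e.
  - by move=> U mU Ua; rewrite mul1e; exact: glued_sub_cell gS mU Ua.
(* Gluing the constant family returns Q, so Q belongs to the conditional closure. *)
have gQ : glued X psi (fun=> Q) Q.
  by move=> U mU; apply: prob1_partition => //; have [] := hQQ _ hQ.
have DQ : fdiv mu X f P Q = \sum_(a : A) (p a)%:E * dQ a.
  rewrite (fdiv_glued mcell hf Pmu _ gQ); last by move=> _; exact: QQmu.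
  by apply: eq_bigr => a _; rewrite pdQ.
have DS : fdiv mu X f P Qstar = \sum_(a : A) (p a)%:E * dS a.
  rewrite (fdiv_glued mcell hf Pmu _ gS); last by move=> b; exact: QQmu.
  by apply: eq_bigr => a _; rewrite pdS.
(* With [a = a'], the hypothesis excludes infinite divergences, because
[+oo - +oo = -oo]. *)
have dQ_fin a : dQ a \is a fin_num.
  by have := hEGT a a; rewrite -/(dQ a); case: (dQ a).
have dQ_delta a b : dQ a <= dQ b + delta%:E.
  have := hEGT a b; rewrite -/(dQ a) -/(dQ b).
  rewrite -(fineK (dQ_fin a)) -(fineK (dQ_fin b)) -EFinB -EFinD !lee_fin.
  by rewrite ler_norml => /andP[_]; rewrite lerBlDl.
have dS_le a : dS a <= dQ a.
  (* The finite bound [z] is the divergence of Q itself, a competitor of [Qstar] in the closure. *)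
  apply: (@weighted_sum_term_le _ _ _ p0 dS a (dQ a) (\sum_(b : A) (p b)%:E * dQ b)).
  - move=> b; apply: fdiv_gtNy => //.
      by apply: cond_dist_ac => //; exact: hPnt.
    by apply: cond_dist_ac => //; exact: cond_gt0.
  - rewrite ltey_eq; apply/orP; left; apply/sum_fin_numP => b _ _.
    by rewrite fin_numM.
  - rewrite -DS -DQ; apply: Smin; apply/closureP.
    by exists (fun=> Q).
  (* The second competitor [S'] is [Qstar] with its part on the cell of [a] replaced by that of Q;
     its divergence differs from that of [Qstar] in this single term. *)
  have [S' gS'] := glued_replace mcell P gS (etrans (Qodds a) (esym (Sodds a))).
  have q'Q b : QQ (if b == a then Q else q b) by case: ifP.
  rewrite -DS; apply: (@le_trans _ _ (fdiv mu X f P S')).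
    by apply: Smin; apply/closureP; exists (fun b => if b == a then Q else q b).
  rewrite (fdiv_glued mcell hf Pmu _ gS') => [|b]; last exact: QQmu.
  rewrite (bigD1 a)//= eqxx pdQ leeD2l// le_eqVlt; apply/orP; left; apply/eqP.
  by apply: eq_bigr => b /negbTE ->; rewrite pdS.
(* The initial value -oo of the maximum lies below everything, so only the bound for each [a]
   remains. *)
rewrite leeBlDr// DQ; apply: bigmax_le => [|a _]; first exact: leNye.
apply: (le_trans (dS_le a)); apply: le_weighted_mean => //.
exact: sum_fine_odds.
Qed.
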